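(* For every integer $n \ge 0$ let $$a_n = \bigl|\{(i,j) : i,j \text{ integers},\ 0 \le i,j < n \text{ and } i \mathbin{\mathrm{AND}} j > 0\}\bigr|.$$ Then $(a_n)_{n\ge 0}$ is the sequence given by the initial conditions $a_0 = a_1 = 0$ and the recursions $$a_{2n} = 3a_n + n^2 \quad (n \ge 0), \qquad a_{2n+1} = a_n + 2a_{n+1} + n^2 - 1 \quad (n \ge 1).$$
   Context: For nonnegative integers $i,j$, $i \mathbin{\mathrm{AND}} j$ denotes the bitwise AND of $i$ and $j$: the nonnegative integer whose binary digit in each position is $1$ exactly when both $i$ and $j$ have binary digit $1$ in that position. *)

(* Defs.v *)
From mathcomp Require Import all_boot all_order all_algebra.

Set Implicit Arguments.
Unset Strict Implicit.
Unset Printing Implicit Defensive.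

Import GRing.Theory Num.Theory.
Local Open Scope ring_scope.

Definition and_count (n : nat) : nat :=
  #|[set p : 'I_n * 'I_n | (0 < Nat.land p.1 p.2)%N]|.

(* Integer-valued, so that the subtraction below is not truncated. *)
Definition and_recursion (a : nat -> int) : Prop :=
  [/\ a 0%N = 0,
      a 1%N = 0,
      forall n : nat, a (2 * n)%N = 3 * a n + n%:Z ^+ 2
    & forall n : nat, (1 <= n)%N ->
        a (2 * n + 1)%N = a n + 2 * a (n + 1)%N + n%:Z ^+ 2 - 1].

(* Main.v *)
(** Split the pairs (i, j) by the parities of i and j. Since
    (2i + a) AND (2j + b) = 2 (i AND j) + ab, the block a = b = 1 is entirely
    counted, while each of the three others is a smaller copy of the counting
    problem; for odd side lengths two of these copies live on rectangles of
    sides n+1 and n, which symmetry reduces to squares. *)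

Require Import Defs.
From Stdlib Require PeanoNat.
From mathcomp Require Import all_boot all_order all_algebra.
From mathcomp Require Import zify.

Set Implicit Arguments.
Unset Strict Implicit.
Unset Printing Implicit Defensive.

Import GRing.Theory Num.Theory.
Local Open Scope ring_scope.

Definition land_pos (i j : nat) : nat := (0 < Nat.land i j)%N.

(** Summing a 0/1 indicator over [nat], rather than taking a cardinal over ordinals, allows ranges
    to be split by parity or extended by one. *)
Definition and_count_rect (m n : nat) : nat :=
  (\sum_(0 <= i < m) \sum_(0 <= j < n) land_pos i j)%N.

Lemma and_countE (n : nat) : and_count n = and_count_rect n n.
Proof.
rewrite /and_count_rect big_mkord; under [RHS]eq_bigr do rewrite big_mkord.
rewrite /and_count pair_big -sum1dep_card big_mkcond.
by apply: eq_bigr => p _; rewrite /land_pos; case: (0 < _)%N.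
Qed.

Lemma land_posC (i j : nat) : land_pos i j = land_pos j i.
Proof. by rewrite /land_pos PeanoNat.Nat.land_comm. Qed.

(** Evaluates the corner (n, n) in [and_count_rectS], the source of the -1 in the odd recursion. *)
Lemma land_pos_diag (n : nat) : land_pos n n = (0 < n)%N.
Proof. by rewrite /land_pos PeanoNat.Nat.land_diag. Qed.

(** With the parities as booleans, [false + 2 * i] and [true + 2 * i] convert to [2 * i] and
    [1 + 2 * i], so each of the four blocks below is a direct instance. *)
Lemma land_pos_double (i j : nat) (a b : bool) :
  land_pos (a + 2 * i) (b + 2 * j) = (a && b) || (0 < Nat.land i j)%N.
Proof.
rewrite /land_pos addnC (addnC b); congr nat_of_bool.
case: a; case: b; rewrite /= ?addn0.
- by rewrite PeanoNat.Nat.land_odd_odd; lia.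
- by rewrite PeanoNat.Nat.land_odd_even; lia.
- by rewrite PeanoNat.Nat.land_even_odd; lia.
- by rewrite PeanoNat.Nat.land_even_even; lia.
Qed.

Lemma sum_double (F : nat -> nat) (n : nat) :
  (\sum_(0 <= i < 2 * n) F i = \sum_(0 <= i < n) F (2 * i) + \sum_(0 <= i < n) F (1 + 2 * i))%N.
Proof.
elim: n => [|n IHn]; first by rewrite muln0 !big_geq.
by rewrite mulnS !addSn !big_nat_recr //= IHn -addnA addnACA.
Qed.

Lemma sum_double1 (F : nat -> nat) (n : nat) :
  (\sum_(0 <= i < 2 * n + 1) F i
   = \sum_(0 <= i < n.+1) F (2 * i) + \sum_(0 <= i < n) F (1 + 2 * i))%N.
Proof. by rewrite addn1 !big_nat_recr //= sum_double addnAC. Qed.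

Lemma and_count_rect_ee (m n : nat) :
  (\sum_(0 <= i < m) \sum_(0 <= j < n) land_pos (2 * i) (2 * j) = and_count_rect m n)%N.
Proof.
by do 2![apply: eq_bigr => ? _]; exact: (land_pos_double _ _ false false).
Qed.

Lemma and_count_rect_eo (m n : nat) :
  (\sum_(0 <= i < m) \sum_(0 <= j < n) land_pos (2 * i) (1 + 2 * j)
   = and_count_rect m n)%N.
Proof.
by do 2![apply: eq_bigr => ? _]; exact: (land_pos_double _ _ false true).
Qed.

Lemma and_count_rect_oe (m n : nat) :
  (\sum_(0 <= i < m) \sum_(0 <= j < n) land_pos (1 + 2 * i) (2 * j)
   = and_count_rect m n)%N.
Proof.
by do 2![apply: eq_bigr => ? _]; exact: (land_pos_double _ _ true false).
Qed.

Lemma and_count_rect_oo (m n : nat) :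
  (\sum_(0 <= i < m) \sum_(0 <= j < n) land_pos (1 + 2 * i) (1 + 2 * j) = m * n)%N.
Proof.
rewrite -[m in RHS]subn0 -sum_nat_const_nat; apply: eq_bigr => i _.
rewrite -[n in RHS]subn0 -[RHS]muln1 -sum_nat_const_nat.
by apply: eq_bigr => j _; exact: (land_pos_double _ _ true true).
Qed.

Lemma and_count_rectC (m n : nat) : and_count_rect m n = and_count_rect n m.
Proof.
rewrite /and_count_rect exchange_big_nat.
by do 2![apply: eq_bigr => ? _]; exact: land_posC.
Qed.

Lemma and_count_rectSr (m n : nat) :
  and_count_rect m n.+1 = (and_count_rect m n + \sum_(0 <= i < m) land_pos i n)%N.
Proof.
by rewrite -big_split; apply: eq_bigr => i _; rewrite big_nat_recr.
Qed.

(* The (n+1) x n and n x (n+1) rectangles cover the (n+1)-square, with the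
   n-square counted twice, except for the corner (n, n). *)
Lemma and_count_rectS (n : nat) : (0 < n)%N ->
  and_count n + and_count n.+1 = (2 * and_count_rect n.+1 n).+1.
Proof.
move=> n_gt0; rewrite !and_countE and_count_rectSr big_nat_recr //=.
rewrite land_pos_diag n_gt0 and_count_rectC and_count_rectSr.
by move: (and_count_rect n n) (\sum_(0 <= i < n) _)%N => A S /=; lia.
Qed.

Lemma and_count_double (n : nat) : and_count (2 * n) = (3 * and_count n + n ^ 2)%N.
Proof.
rewrite !and_countE {1}/and_count_rect sum_double.
(* The range of j is split for even i here and for odd i on the next line, which yields the four
   blocks. *)
under eq_bigr => i _ do rewrite sum_double.
under [X in (_ + X)%N]eq_bigr => i _ do rewrite sum_double.
rewrite !big_split /= and_count_rect_ee and_count_rect_eo.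
rewrite and_count_rect_oe and_count_rect_oo; lia.
Qed.

(** The blocks are the (n+1)-square, two rectangles with equal counts, and a full n by (n) block of
    odd pairs; [and_count_rectS] eliminates both rectangles at once. The successor on the left
    avoids truncated subtraction. *)
Lemma and_count_double1 (n : nat) : (0 < n)%N ->
  (and_count (2 * n + 1)).+1 = (and_count n + 2 * and_count n.+1 + n ^ 2)%N.
Proof.
move=> /and_count_rectS; rewrite !and_countE.
(* The first three occurrences belong to the rectangle identity, kept as a premise; the fourth is
   the square of side 2n+1. *)
rewrite {4}/and_count_rect sum_double1.
under eq_bigr => i _ do rewrite sum_double1.
under [X in (_ + X)%N]eq_bigr => i _ do rewrite sum_double1.
rewrite !big_split /= and_count_rect_ee and_count_rect_eo.
rewrite and_count_rect_oe and_count_rect_oo (and_count_rectC n); lia.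
Qed.

Lemma and_recursion_and_count : and_recursion (fun n => (and_count n)%:Z).
Proof.
split=> [||n|n n_gt0].
- by rewrite and_countE /and_count_rect big_geq.
- by rewrite and_countE /and_count_rect !big_nat1.
- by rewrite and_count_double; lia.
- by have := and_count_double1 n_gt0; rewrite (addn1 n); lia.
Qed.

(** Strong induction works since, beyond the two initial values, each recursion refers only to
    strictly smaller indices. *)
Lemma and_recursion_unique (a b : nat -> int) :
  and_recursion a -> and_recursion b -> a =1 b.
Proof.
move=> [a0 a1 aE aO] [b0 b1 bE bO]; elim/ltn_ind => n IHn.
have [n_le1|n_gt1] := leqP n 1.
  by case: n n_le1 {IHn} => [|[|//]] _; [rewrite a0 b0 | rewrite a1 b1].
(* With k = [n./2] positive, the odd recursion applies and k + 1 < 2k + 1. *)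
have half_gt0 : (0 < n./2)%N by lia.
have [n_odd|n_even] := boolP (odd n).
  have -> : n = (2 * n./2 + 1)%N by lia.
  by rewrite aO // bO // !IHn //; lia.
have -> : n = (2 * n./2)%N by lia.
by rewrite aE bE IHn //; lia.
Qed.

Theorem mainTheorem1 :
  and_recursion (fun n : nat => (and_count n)%:Z) /\
  (forall b : nat -> int, and_recursion b ->
     forall n : nat, b n = (and_count n)%:Z).
Proof.
split=> [|b b_rec]; first exact: and_recursion_and_count.
exact: and_recursion_unique b_rec and_recursion_and_count.
Qed.
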